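(* Let $\delta,\theta\in\mathbb{F}_{q^6}$ and let $f(x)=x^q+\delta x^{q^4}$, $g(x)=x^q+\theta x^{q^4}$ be $q$-polynomials over $\mathbb{F}_{q^6}$. Then the linear sets $L_f$ and $L_g$ are $\mathrm{P\Gamma L}(2,q^6)$-equivalent if and only if \[N_{q^6/q^3}(\delta)=N_{q^6/q^3}(\theta)^\sigma\] for some automorphism $\sigma\in\mathrm{Aut}(\mathbb{F}_{q^3})$.
   Context: For a $q$-polynomial $h$ over $\mathbb{F}_{q^n}$, $L_h=\{\langle (x,h(x))\rangle_{\mathbb{F}_{q^n}} : x\in\mathbb{F}_{q^n}^*\}\subseteq\mathrm{PG}(1,q^n)$. Two point sets $L,L'$ of $\mathrm{PG}(1,q^n)$ are $\mathrm{P\Gamma L}$-equivalent if there exists $\varphi\in\mathrm{P\Gamma L}(2,q^n)$ with $L^\varphi=L'$. $N_{q^6/q^3}(x)=x^{q^3+1}$ is the norm from $\mathbb{F}_{q^6}$ to $\mathbb{F}_{q^3}$. *)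

(* Defs.v *)
From HB Require Import structures.
From mathcomp Require Import all_boot all_order all_algebra.

Set Implicit Arguments.
Unset Strict Implicit.
Unset Printing Implicit Defensive.

Import GRing.Theory.
Local Open Scope ring_scope.

Definition prime_power (q : nat) : Prop :=
  exists p k : nat, [/\ prime p, (0 < k)%N & q = (p ^ k)%N].

Section LinearSets.
Variable F : finFieldType.

Definition vec2 (x y : F) : 'rV[F]_2 := \row_i (if i == 0 then x else y).

(* A point of PG(1, F) is represented by the set of vectors of the
   corresponding one-dimensional F-subspace of F^2. *)
Definition point (v : 'rV[F]_2) : {set 'rV[F]_2} := [set w | w \in <[v]>%VS].

Definition linear_set (h : {poly F}) : {set {set 'rV[F]_2}} :=
  [set point (vec2 x h.[x]) | x : F & x != 0].

Definition GammaL2 (phi : 'rV[F]_2 -> 'rV[F]_2) : Prop :=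
  bijective phi /\
  exists tau : {rmorphism F -> F}, bijective tau /\
    forall (a : F) (u v : 'rV[F]_2), phi (a *: u + v) = tau a *: phi u + phi v.

(* The elements of PGammaL(2, F) are the maps P |-> phi @: P on points
   induced by the elements phi of GammaL(2, F). *)
Definition PGammaL_equivalent (L L' : {set {set 'rV[F]_2}}) : Prop :=
  exists2 phi : 'rV[F]_2 -> 'rV[F]_2,
    GammaL2 phi & [set phi @: P | P : {set 'rV[F]_2} in L] = L'.

(* When #|F| is a power of Q, this is the unique subfield of F of order Q. *)
Definition subfield_of_order (Q : nat) : {set F} := [set x | x ^+ Q == x].

(* An automorphism of a subfield K of F, given as a function on F of which only
   the values on K matter. *)
Definition subfield_aut (K : {set F}) (sigma : F -> F) : Prop :=
  [/\ {in K &, injective sigma},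
      sigma @: K = K,
      sigma 1 = 1,
      {in K &, {morph sigma : x y / x + y}}
    & {in K &, {morph sigma : x y / x * y}}].

(* When #|F| = Q ^ 2, this is the norm of F over its subfield of order Q. *)
Definition quadratic_norm (Q : nat) (x : F) : F := x ^+ Q.+1.

End LinearSets.

(* Main.v *)
Require Import Defs.
From mathcomp Require Import all_boot all_order all_algebra.
From mathcomp Require Import all_fingroup finfield ring zify.

Set Implicit Arguments.
Unset Strict Implicit.
Unset Printing Implicit Defensive.

Import GRing.Theory.
Local Open Scope ring_scope.

(** Semilinearity reduces the forward direction to a linear map with matrix
    [(a, b; c, d)] and to the binomial [f] with coefficient [tau delta]; such a
    map sends [U_f] to [U_h], where [h] is the q-polynomial with
    [h o (a x + b f) = c x + d f].  For any q-polynomial [h], the determinant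
    [P_h(m)] of the Dickson matrix of [h(x) - m x] lies in [F_q] and vanishes
    exactly when [m] is a slope of [L_h], so [P_h ^ (q - 1)] is, up to
    complement, the indicator function of the slopes.  Its degree in [m] is at
    most [q^6 - 1], so [L_h = L_g] gives [P_h = P_g] as polynomials, i.e. the
    Dickson matrices of [h] and [g] have the same principal minors.  The minors
    of order at most 3 force [h] to be supported on [{1, 4}] or [{2, 5}], and
    those on the rows [{0, 1, 2}] and [{0, 2, 4}] give the norm condition.

    Conversely, [sigma] sends the norm [T] of [theta] to a root of
    [prod_j (X - T ^ (p ^ j))], so it acts on [T] as a power of Frobenius;
    Hilbert 90 then provides a diagonal matrix realising the equivalence. *)

Lemma poly_eq_on_finField (F : finFieldType) (P Q : {poly F}) :
  (size P <= #|F|)%N -> (size Q <= #|F|)%N ->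
  (forall x, P.[x] = Q.[x]) -> P = Q.
Proof.
move=> sP sQ PQ; apply/eqP; rewrite -subr_eq0; apply/negPn/negP => nz.
have := max_poly_roots nz _ (enum_uniq F).
have -> : all (root (P - Q)) (enum F).
  by apply/allP => x _; rewrite /root !hornerE PQ subrr.
move=> /(_ isT); rewrite -cardE ltnNge => /negP; apply.
by rewrite (leq_trans (size_polyD _ _)) // size_polyN geq_max sP.
Qed.

Lemma det_sub_diag (R : comNzRingType) n (A : 'M[R]_n) (x : 'I_n -> R) :
  \det (A - diag_mx (\row_i x i)) =
  \sum_(J : {set 'I_n}) (\prod_(i in J) x i) *
     \det (\matrix_(i, j) (if i \in J then - (i == j)%:R else A i j)).
Proof.
rewrite /determinant; under [RHS]eq_bigr do rewrite big_distrr /=.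
rewrite [RHS]exchange_big; apply: eq_bigr => s _ /=.
transitivity ((-1) ^+ s * \prod_i ((x i * - (i == s i)%:R) + A i (s i))).
  congr (_ * _); apply: eq_bigr => i _.
  by rewrite !mxE addrC mulrN mulr_natr.
rewrite bigA_distr big_distrr; apply: eq_bigr => J _ /=.
rewrite mulrCA; congr (_ * _).
rewrite [\prod_(i in J) _]big_mkcond -big_split; apply: eq_bigr => i _ /=.
by rewrite mxE; case: ifP => _; rewrite ?mul1r.
Qed.

Definition contract (R : Type) (A : nat -> nat -> R) (k i j : nat) : R :=
  A (bump k i) (bump k j).

Lemma det_row_unit (R : comNzRingType) n (A : nat -> nat -> R) k :
  (k <= n)%N ->
  (forall j, (j <= n)%N -> A k j = - (k == j)%:R) ->
  \det (\matrix_(i < n.+1, j < n.+1) A i j) =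
  - \det (\matrix_(i < n, j < n) contract A k i j).
Proof.
move=> kn Ak; have kn1 : (k < n.+1)%N by [].
rewrite (expand_det_row _ (Ordinal kn1)) (bigD1 (Ordinal kn1)) //= big1 => [|j].
  rewrite mxE Ak // eqxx addr0 mulN1r /cofactor addnn -signr_odd odd_double mul1r.
  by congr (- \det _); apply/matrixP => i j; rewrite !mxE.
move/negPf; rewrite eq_sym -val_eqE /= => kj.
by rewrite mxE Ak ?kj ?oppr0 ?mul0r // -ltnS.
Qed.

Lemma det1_nat (R : comNzRingType) (A : nat -> nat -> R) :
  \det (\matrix_(i < 1, j < 1) A i j) = A 0%N 0%N.
Proof. by rewrite det_mx11 mxE. Qed.

Lemma det2_nat (R : comNzRingType) (A : nat -> nat -> R) :
  \det (\matrix_(i < 2, j < 2) A i j) = A 0%N 0%N * A 1%N 1%N - A 0%N 1%N * A 1%N 0%N.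
Proof.
rewrite (expand_det_row _ ord0) !big_ord_recl big_ord0 /cofactor !det_mx11 !mxE /=.
rewrite /bump /=; ring.
Qed.

Lemma det3_nat (R : comNzRingType) (A : nat -> nat -> R) :
  \det (\matrix_(i < 3, j < 3) A i j) =
  A 0%N 0%N * (A 1%N 1%N * A 2%N 2%N - A 1%N 2%N * A 2%N 1%N)
  - A 0%N 1%N * (A 1%N 0%N * A 2%N 2%N - A 1%N 2%N * A 2%N 0%N)
  + A 0%N 2%N * (A 1%N 0%N * A 2%N 1%N - A 1%N 1%N * A 2%N 0%N).
Proof.
have minor (k : 'I_3) : row' ord0 (col' k (\matrix_(i < 3, j < 3) A i j)) =
    \matrix_(i < 2, j < 2) A i.+1 (bump k j).
  by apply/matrixP => i j; rewrite !mxE.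
rewrite (expand_det_row _ ord0) !big_ord_recl big_ord0 /cofactor !minor.
rewrite !(det2_nat (fun i j => A i.+1 (bump _ j))) !mxE /= /bump /=; ring.
Qed.

Lemma sum_expn_inj q n : (1 < q)%N ->
  injective (fun J : {set 'I_n} => \sum_(i in J) q ^ i)%N.
Proof.
move=> q1 J K.
have indicator (L : {set 'I_n}) :
    (\sum_(i in L) q ^ i = \sum_(i < n) (i \in L) * q ^ i)%N.
  by rewrite big_mkcond; apply: eq_bigr => i _; case: (i \in L); rewrite ?mul1n.
rewrite !indicator => e.
suff main m (b c : 'I_m -> bool) :
    (\sum_(i < m) b i * q ^ i = \sum_(i < m) c i * q ^ i)%N -> b =1 c.
  by apply/setP => i; apply: (main n (fun i => i \in J) (fun i => i \in K)).
elim: m b c => [|m IH] b c; first by move=> _ [].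
have shift (d : 'I_m.+1 -> bool) : (\sum_(i < m.+1) d i * q ^ i =
    (\sum_(i < m) d (lift ord0 i) * q ^ i) * q + d ord0)%N.
  rewrite big_ord_recl muln1 addnC big_distrl /=; congr (_ + _)%N.
  by apply: eq_bigr => i _; rewrite /bump /= add1n expnSr mulnA.
have small (d : bool) : (d < q)%N by case: d => //; apply: ltnW.
rewrite !shift => e0.
have b0 : b ord0 = c ord0.
  have := congr1 (modn^~ q) e0; rewrite !modnMDl !modn_small ?small //.
  by do 2!case: (_ ord0).
have bl : forall i, b (lift ord0 i) = c (lift ord0 i).
  apply: (IH (fun i => b (lift ord0 i)) (fun i => c (lift ord0 i))).
  have := congr1 (divn^~ q) e0.
  by rewrite !divnMDl ?(ltnW q1) // !divn_small ?small // !addn0.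
by move=> i; case: (unliftP ord0 i) => [j|] ->.
Qed.

Section QPolynomials.

Variables (q n : nat) (F : finFieldType).
Hypothesis q_gt1 : (1 < q)%N.
Hypothesis n_gt0 : (0 < n)%N.
Hypothesis cardF : #|F| = (q ^ n)%N.
Hypothesis frobD : forall x y : F, (x + y) ^+ q = x ^+ q + y ^+ q.

Let q_gt0 : (0 < q)%N := ltnW q_gt1.

Lemma frob_iterD i (x y : F) : (x + y) ^+ (q ^ i) = x ^+ (q ^ i) + y ^+ (q ^ i).
Proof.
by elim: i => [|i IH]; rewrite ?expr1 // expnSr !exprM IH frobD.
Qed.

Lemma frob_iter_sum i (I : Type) (r : seq I) (P : pred I) (G : I -> F) :
  (\sum_(j <- r | P j) G j) ^+ (q ^ i) = \sum_(j <- r | P j) G j ^+ (q ^ i).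
Proof.
apply: (big_morph (fun x => x ^+ (q ^ i)) (@frob_iterD i)).
by rewrite expr0n expn_eq0 -leqn0 leqNgt q_gt0.
Qed.

Lemma frob_iterN i (x : F) : (- x) ^+ (q ^ i) = - x ^+ (q ^ i).
Proof.
apply/eqP; rewrite -subr_eq0 opprK -frob_iterD addNr.
by rewrite expr0n expn_eq0 -leqn0 leqNgt q_gt0.
Qed.

Lemma frob_iter_mod i (x : F) : x ^+ (q ^ (i %% n)) = x ^+ (q ^ i).
Proof.
rewrite {2}(divn_eq i n); elim: (i %/ n)%N => [|m IH] //.
by rewrite mulSn -addnA expnD exprM -cardF expf_card.
Qed.

(* Coefficients are indexed by [nat], but only those of index below [n]
   matter: [h] stands for the q-polynomial [\sum_(i < n) h i x^(q^i)]. *)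
Definition qlin (h : nat -> F) (x : F) : F := \sum_(i < n) h i * x ^+ (q ^ i).

Definition dickson_entry (h : nat -> F) (i j : nat) : F :=
  h ((j + (n - i)) %% n)%N ^+ (q ^ i).

Definition dickson (h : nat -> F) : 'M[F]_n :=
  \matrix_(i < n, j < n) dickson_entry h i j.

Lemma frob_iter_qlin h x (i : 'I_n) :
  qlin h x ^+ (q ^ i) = \sum_j dickson h i j * x ^+ (q ^ j).
Proof.
pose r (j : 'I_n) : 'I_n := Ordinal (ltn_pmod (j + (n - i)) n_gt0).
have rE (j : 'I_n) : (r j + i = j %[mod n])%N.
  by rewrite /= modnDml -addnA subnK ?modnDr // ltnW.
have r_inj : injective r.
  move=> j k jk; apply: val_inj.
  by rewrite /= -(modn_small (ltn_ord j)) -(modn_small (ltn_ord k)) -!rE jk.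
rewrite frob_iter_sum (reindex_inj r_inj); apply: eq_bigr => j _.
rewrite mxE exprMn -exprM -expnD; congr (_ * _).
by rewrite -[in LHS]frob_iter_mod rE frob_iter_mod.
Qed.

Lemma qlin_eq0 h : (forall x, qlin h x = 0) -> forall i : 'I_n, h i = 0.
Proof.
move=> h0 i; pose P : {poly F} := \sum_(j < n) h j *: 'X^(q ^ j).
have P0 : P = 0.
  apply: poly_eq_on_finField => [||x]; rewrite ?size_poly0 //.
    apply: (leq_trans (size_sum _ _ _)); apply/bigmax_leqP => j _.
    rewrite (leq_trans (size_scale_leq _ _)) // size_polyXn cardF.
    by rewrite ltn_exp2l.
  by rewrite horner0 -(h0 x) horner_sum; apply: eq_bigr => j _; rewrite !hornerE.
have := congr1 (fun R : {poly F} => R`_(q ^ i)) P0.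
rewrite coef0 coef_sum (bigD1 i) //= big1 ?addr0 => [|j ji].
  by rewrite coefZ coefXn eqxx mulr1.
by rewrite coefZ coefXn eqn_exp2l // val_eqE eq_sym (negPf ji) mulr0.
Qed.

Lemma qlinB h x y : qlin h (x - y) = qlin h x - qlin h y.
Proof.
rewrite /qlin -sumrB; apply: eq_bigr => i _.
by rewrite frob_iterD frob_iterN mulrBr.
Qed.

Lemma qlin_at0 h : qlin h 0 = 0.
Proof. by have := qlinB h 0 0; rewrite !subrr. Qed.

Lemma qlin_bij h : (forall x, qlin h x = 0 -> x = 0) -> bijective (qlin h).
Proof.
move=> h0; apply: injF_bij => x y xy; apply/eqP.
by rewrite -subr_eq0; apply/eqP/h0; rewrite qlinB xy subrr.
Qed.

Lemma det_dickson_neq0 h :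
  (forall x, qlin h x = 0 -> x = 0) -> \det (dickson h) != 0.
Proof.
move=> h0; apply/det0P => -[v nzv vD].
case/negP: nzv; apply/eqP/rowP => i; rewrite mxE.
pose c (k : nat) := if insub k is Some k' then v 0 k' else 0.
have cE (k : 'I_n) : c k = v 0 k by rewrite /c valK.
rewrite -cE; apply: qlin_eq0 => y.
have [h' _ hK] := qlin_bij h0; rewrite -(hK y).
rewrite /qlin -/(qlin h (h' y)).
under eq_bigr do rewrite frob_iter_qlin cE big_distrr /=.
rewrite exchange_big big1 // => j _; under eq_bigr do rewrite mulrA.
by rewrite -big_distrl /=; have /rowP/(_ j) := vD; rewrite !mxE => ->; rewrite mul0r.
Qed.

Lemma det_dickson_eq0 h x : x != 0 -> qlin h x = 0 -> \det (dickson h) = 0.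
Proof.
move=> nzx hx; apply/eqP; rewrite -det_tr; apply/det0P.
exists (\row_j x ^+ (q ^ j)).
  apply: contra_neq nzx => /rowP/(_ (Ordinal n_gt0)).
  by rewrite !mxE expr1.
apply/rowP => i; rewrite !mxE.
under eq_bigr do rewrite 2!mxE mulrC.
rewrite -frob_iter_qlin hx expr0n expn_eq0 -leqn0 leqNgt q_gt0 //.
Qed.

(* The Frobenius map sends the matrix to its conjugate by the cyclic shift. *)
Lemma det_dickson_frob h : \det (dickson h) ^+ q = \det (dickson h).
Proof.
pose t := perm (@ordS_inj n).
transitivity (\det (row_perm t (col_perm t (dickson h)))); last first.
  rewrite row_permE col_permE !det_mulmx !det_perm odd_permV.
  by rewrite mulrCA -signr_addb addbb mulr1.
rewrite /determinant -[q in LHS]expn1 frob_iter_sum; apply: eq_bigr => s _.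
rewrite expn1 exprMn -prodrXl; congr (_ * _).
  by case: (s : bool); rewrite ?expr1n // expr1 -[q]expn1 frob_iterN expr1n.
apply: eq_bigr => i _; rewrite !mxE !permE /dickson_entry -exprM -expnSr.
rewrite -[LHS]frob_iter_mod /=; congr (h _ ^+ _).
have [ltin|] := ltnP i.+1 n; last first.
  move=> le; have -> : i = n.-1 :> nat by have := ltn_ord i; lia.
  rewrite prednK // modnn subn0 modnDr modn_mod.
  have -> : (n - n.-1 = 1)%N by lia.
  by rewrite addn1.
rewrite (modn_small ltin) modnDml; congr (_ %% _)%N; lia.
Qed.

Lemma qlinBlin h m x :
  qlin (fun k => h k - m * (k == 0%N)%:R) x = qlin h x - m * x.
Proof.
rewrite /qlin; under eq_bigr do rewrite mulrBl.
rewrite sumrB; congr (_ - _); rewrite (bigD1 (Ordinal n_gt0)) //= big1 => [|i].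
  by rewrite addr0 mulr1 expr1.
by rewrite -val_eqE /= => /negPf ->; rewrite mulr0 mul0r.
Qed.

Lemma dicksonBlin h m :
  dickson (fun k => h k - m * (k == 0%N)%:R) =
  dickson h - diag_mx (\row_i m ^+ (q ^ i)).
Proof.
apply/matrixP => i j; rewrite !mxE /dickson_entry frob_iterD frob_iterN exprMn.
rewrite -[in RHS]mulr_natr; congr (_ - _ * _).
have -> : ((j + (n - i)) %% n == 0)%N = (i == j).
  have := ltn_ord i; have := ltn_ord j; rewrite -val_eqE /= => ltj lti.
  have [ij|ji] := leqP i j; last by rewrite modn_small; lia.
  have -> : (j + (n - i) = j - i + n)%N by lia.
  by rewrite modnDr modn_small; lia.
by case: eqP; rewrite ?expr1n // expr0n expn_eq0 -leqn0 leqNgt q_gt0.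
Qed.

Definition slope_poly (h : nat -> F) : {poly F} :=
  \det (map_mx polyC (dickson h) - diag_mx (\row_(i < n) 'X^(q ^ i))).

Lemma horner_slope_poly h m :
  (slope_poly h).[m] = \det (dickson (fun k => h k - m * (k == 0%N)%:R)).
Proof.
rewrite /slope_poly -[_.[m]]/(horner_eval m _) -det_map_mx dicksonBlin.
congr (\det _); apply/matrixP => i j; rewrite !mxE.
by rewrite /= /horner_eval hornerD hornerC hornerN hornerMn hornerXn.
Qed.

Lemma slope_poly_root h m :
  reflect (exists2 x, x != 0 & qlin h x = m * x) (root (slope_poly h) m).
Proof.
rewrite /root horner_slope_poly; apply: (iffP idP) => [d0|[x nzx hx]].
  suff /exists_inP[x nzx /eqP hx] : [exists x in [pred x | x != 0], qlin h x == m * x].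
    by exists x.
  move: d0; apply: contraLR.
  rewrite negb_exists_in => /forall_inP nx; apply: det_dickson_neq0 => x.
  rewrite qlinBlin => /eqP; rewrite subr_eq0 => hx; apply/eqP; apply/negPn/negP.
  by move/nx; rewrite hx.
apply/eqP; apply: (det_dickson_eq0 nzx).
by rewrite qlinBlin hx subrr.
Qed.

(* Up to sign, the principal minor of the Dickson matrix on the complement of [J]. *)
Definition minor_det (h : nat -> F) (J : {set 'I_n}) : F :=
  \det (\matrix_(i, j) (if i \in J then - (i == j)%:R else dickson h i j)).

Lemma slope_polyE h :
  slope_poly h = \sum_(J : {set 'I_n}) minor_det h J *: 'X^(\sum_(i in J) q ^ i).
Proof.
rewrite /slope_poly det_sub_diag; apply: eq_bigr => J _.
rewrite -mul_polyC mulrC; congr (_ * _).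
  rewrite /minor_det -det_map_mx; congr (\det _); apply/matrixP => i j.
  by rewrite !mxE; case: ifP => // _; rewrite rmorphN /= rmorph_nat.
by rewrite (big_morph (fun k => 'X^k : {poly F}) (@exprD _ 'X) (expr0 _)).
Qed.

Lemma coef_slope_poly h (J : {set 'I_n}) :
  (slope_poly h)`_(\sum_(i in J) q ^ i)%N = minor_det h J.
Proof.
rewrite slope_polyE coef_sum (bigD1 J) //= [X in _ + X]big1 => [|K KJ].
  by rewrite coefZ coefXn eqxx mulr1 addr0.
rewrite coefZ coefXn; case: eqP => [/(sum_expn_inj q_gt1) e|]; rewrite ?mulr0 //.
by rewrite e eqxx in KJ.
Qed.

Lemma coef_slope_polyT h : (slope_poly h)`_(\sum_(i in [set: 'I_n]) q ^ i)%N = (-1) ^+ n.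
Proof.
rewrite coef_slope_poly /minor_det -[RHS](det_scalar n (-1)); congr (\det _).
by apply/matrixP => i j; rewrite !mxE in_setT mulNrn.
Qed.

Lemma size_slope_poly h : (size (slope_poly h ^+ q.-1) <= #|F|)%N.
Proof.
have sz : (size (slope_poly h) <= (\sum_(i < n) q ^ i).+1)%N.
  rewrite slope_polyE; apply: (leq_trans (size_sum _ _ _)).
  apply/bigmax_leqP => J _; rewrite (leq_trans (size_scale_leq _ _)) //.
  rewrite size_polyXn ltnS [leqRHS](bigID (mem J)) /= leq_addr //.
rewrite (leq_trans (size_poly_exp_leq _ _)) // cardF.
have -> : (q ^ n = (q.-1 * \sum_(i < n) q ^ i).+1)%N.
  by rewrite -predn_exp prednK // expn_gt0 q_gt0.
by rewrite ltnS mulnC leq_mul //; case: (size _) sz.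
Qed.

Lemma slope_poly_eq h g :
  (forall m, (exists2 x, x != 0 & qlin h x = m * x) <->
             (exists2 x, x != 0 & qlin g x = m * x)) ->
  slope_poly h = slope_poly g.
Proof.
move=> hg.
have pow k m : (slope_poly k).[m] ^+ q.-1 = (~~ root (slope_poly k) m)%:R.
  rewrite /root; have [->|nz] := eqVneq (slope_poly k).[m] 0.
    by rewrite expr0n -subn1 subn_eq0 leqNgt q_gt1.
  apply: (mulfI nz); rewrite mulr1 -exprS prednK //.
  by rewrite horner_slope_poly det_dickson_frob.
have roots m : root (slope_poly h) m = root (slope_poly g) m.
  by apply/slope_poly_root/slope_poly_root => /hg.
have powE : slope_poly h ^+ q.-1 = slope_poly g ^+ q.-1.
  apply: poly_eq_on_finField => [||m]; rewrite ?size_slope_poly //.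
  by rewrite !horner_exp !pow roots.
have q1 : (0 < q.-1)%N by rewrite -subn1 subn_gt0.
have : slope_poly h %= slope_poly g.
  by rewrite /eqp -(dvdp_pexp2r _ _ q1) powE dvdpp -(dvdp_pexp2r _ _ q1) powE dvdpp.
case/eqpP => -[c d] /= /andP[nzc nzd] e.
have := congr1 (fun P : {poly F} => P`_(\sum_(i in [set: 'I_n]) q ^ i)%N) e.
rewrite !coefZ !coef_slope_polyT; have /mulIf inj : (-1) ^+ n != 0 :> F by rewrite signr_eq0.
by move/inj => cd; move: e; rewrite -cd; apply: scalerI.
Qed.

Lemma minor_det_eq h g (K : pred nat) :
  (forall m, (exists2 x, x != 0 & qlin h x = m * x) <->
             (exists2 x, x != 0 & qlin g x = m * x)) ->
  \det (\matrix_(i < n, j < n)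
     (if K i then dickson_entry h i j else - (i == j :> nat)%:R)) =
  \det (\matrix_(i < n, j < n)
     (if K i then dickson_entry g i j else - (i == j :> nat)%:R)).
Proof.
move=> hg; have mE k : \det (\matrix_(i < n, j < n)
     (if K i then dickson_entry k i j else - (i == j :> nat)%:R)) =
     minor_det k [set i : 'I_n | ~~ K i].
  congr (\det _); apply/matrixP => i j; rewrite !mxE inE.
  by case: (K i).
by rewrite !mE -!coef_slope_poly (slope_poly_eq hg).
Qed.

Lemma qlin_right_factor u w : (forall x, qlin u x = 0 -> x = 0) ->
  exists h : nat -> F,
    (forall x, qlin h (qlin u x) = qlin w x) /\
    (forall j : 'I_n, \sum_(i < n) h i * dickson_entry u i j = w j).
Proof.
move=> u0; have [v vu] : exists v : 'rV_n, v *m dickson u = \row_(j < n) w j.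
  exists ((\row_(j < n) w j) *m invmx (dickson u)).
  by rewrite mulmxKV // unitmxE unitfE det_dickson_neq0.
pose h (k : nat) := if insub k is Some k' then v 0 k' else 0.
have hE (k : 'I_n) : h k = v 0 k by rewrite /h valK.
have hu (j : 'I_n) : \sum_(i < n) h i * dickson_entry u i j = w j.
  have /rowP/(_ j) := vu; rewrite 2!mxE => <-.
  by apply: eq_bigr => i _; rewrite mxE hE.
exists h; split=> // x.
rewrite {1}/qlin; under eq_bigr do rewrite frob_iter_qlin big_distrr /=.
rewrite exchange_big; apply: eq_bigr => j _.
rewrite -hu big_distrl; apply: eq_bigr => i _ /=.
by rewrite mxE mulrA.
Qed.

End QPolynomials.

Section PrincipalMinors.

Variables (R : comNzRingType) (A : nat -> nat -> R).

Let mixed (K : seq nat) (i j : nat) : R :=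
  if i \in K then A i j else - (i == j)%:R.

Local Ltac unit_row k := rewrite (@det_row_unit _ _ _ k) //;
  try by do 6![case=> //].

Lemma minor_0 : \det (\matrix_(i < 6, j < 6) mixed [:: 0]%N i j) = - A 0%N 0%N.
Proof.
unit_row 5%N; unit_row 4%N; unit_row 3%N; unit_row 2%N; unit_row 1%N.
by rewrite !opprK det1_nat.
Qed.

Lemma minor_01 : \det (\matrix_(i < 6, j < 6) mixed [:: 0; 1]%N i j) =
  A 0%N 0%N * A 1%N 1%N - A 0%N 1%N * A 1%N 0%N.
Proof.
unit_row 5%N; unit_row 4%N; unit_row 3%N; unit_row 2%N.
by rewrite !opprK det2_nat.
Qed.

Lemma minor_02 : \det (\matrix_(i < 6, j < 6) mixed [:: 0; 2]%N i j) =
  A 0%N 0%N * A 2%N 2%N - A 0%N 2%N * A 2%N 0%N.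
Proof.
unit_row 5%N; unit_row 4%N; unit_row 3%N; unit_row 1%N.
by rewrite !opprK det2_nat.
Qed.

Lemma minor_03 : \det (\matrix_(i < 6, j < 6) mixed [:: 0; 3]%N i j) =
  A 0%N 0%N * A 3%N 3%N - A 0%N 3%N * A 3%N 0%N.
Proof.
unit_row 5%N; unit_row 4%N; unit_row 2%N; unit_row 1%N.
by rewrite !opprK det2_nat.
Qed.

Lemma minor_012 : \det (\matrix_(i < 6, j < 6) mixed [:: 0; 1; 2]%N i j) =
  - (A 0%N 0%N * (A 1%N 1%N * A 2%N 2%N - A 1%N 2%N * A 2%N 1%N)
  - A 0%N 1%N * (A 1%N 0%N * A 2%N 2%N - A 1%N 2%N * A 2%N 0%N)
  + A 0%N 2%N * (A 1%N 0%N * A 2%N 1%N - A 1%N 1%N * A 2%N 0%N)).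
Proof.
unit_row 5%N; unit_row 4%N; unit_row 3%N.
by rewrite !opprK det3_nat.
Qed.

Lemma minor_024 : \det (\matrix_(i < 6, j < 6) mixed [:: 0; 2; 4]%N i j) =
  - (A 0%N 0%N * (A 2%N 2%N * A 4%N 4%N - A 2%N 4%N * A 4%N 2%N)
  - A 0%N 2%N * (A 2%N 0%N * A 4%N 4%N - A 2%N 4%N * A 4%N 0%N)
  + A 0%N 4%N * (A 2%N 0%N * A 4%N 2%N - A 2%N 2%N * A 4%N 0%N)).
Proof.
unit_row 5%N; unit_row 3%N; unit_row 1%N.
by rewrite !opprK det3_nat.
Qed.

End PrincipalMinors.

Section NormOfBinomials.

Variables (q : nat) (F : finFieldType).
Hypothesis q_gt1 : (1 < q)%N.
Hypothesis cardF : #|F| = (q ^ 6)%N.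
Hypothesis frobD : forall x y : F, (x + y) ^+ q = x ^+ q + y ^+ q.

Let q_gt0 : (0 < q)%N := ltnW q_gt1.

Definition qbinomial (a b d : F) : nat -> F := nth 0 [:: a; b; 0; 0; b * d; 0].

Lemma qlin_binomial a b d x :
  qlin q 6 (qbinomial a b d) x =
  a * x + b * (x ^+ q + d * x ^+ (q ^ 4)).
Proof.
transitivity (a * x ^+ (q ^ 0) + (b * x ^+ (q ^ 1) + (0 * x ^+ (q ^ 2) +
    (0 * x ^+ (q ^ 3) + (b * d * x ^+ (q ^ 4) + (0 * x ^+ (q ^ 5) + 0)))))).
  by rewrite /qlin !big_ord_recl big_ord0.
rewrite expn0 expn1; ring.
Qed.

Let frob0 i : 0 ^+ (q ^ i) = 0 :> F.
Proof. by rewrite expr0n expn_eq0 -leqn0 leqNgt q_gt0. Qed.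

Lemma same_slopes_coefs (h : nat -> F) theta :
  (forall m, (exists2 x, x != 0 & qlin q 6 h x = m * x) <->
             (exists2 x, x != 0 & qlin q 6 (qbinomial 0 1 theta) x = m * x)) ->
  [/\ h 0 = 0, h 3 = 0, h 1 * h 5 = 0 & h 2 * h 4 = 0] /\
  (h 1 * h 1 ^+ q * h 4 ^+ (q ^ 2) + h 2 * h 5 ^+ q * h 5 ^+ (q ^ 2) = theta ^+ (q ^ 2)
  /\ h 2 * h 2 ^+ (q ^ 2) * h 2 ^+ (q ^ 4) + h 4 * h 4 ^+ (q ^ 2) * h 4 ^+ (q ^ 4) =
     theta * theta ^+ (q ^ 2) * theta ^+ (q ^ 4)).
Proof.
set g := qbinomial 0 1 theta => hg.
have minor_eq (K : seq nat) : _ :=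
  @minor_det_eq q 6 F q_gt1 isT cardF frobD h g (fun i => i \in K) hg.
pose H := dickson_entry q 6 h; pose G := dickson_entry q 6 g.
have h0 : h 0 = 0.
  have : - h 0 ^+ (q ^ 0) = - 0 ^+ (q ^ 0) :> F.
    by have := minor_eq [:: 0]%N; rewrite (minor_0 H) (minor_0 G).
  by rewrite expr1 frob0 => /oppr_inj.
have e03 : h 0 ^+ (q ^ 0) * h 0 ^+ (q ^ 3) - h 3 ^+ (q ^ 0) * h 3 ^+ (q ^ 3) =
    0 ^+ (q ^ 0) * 0 ^+ (q ^ 3) - 0 ^+ (q ^ 0) * 0 ^+ (q ^ 3).
  by have := minor_eq [:: 0; 3]%N; rewrite (minor_03 H) (minor_03 G).
have e01 : h 0 ^+ (q ^ 0) * h 0 ^+ (q ^ 1) - h 1 ^+ (q ^ 0) * h 5 ^+ (q ^ 1) =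
    0 ^+ (q ^ 0) * 0 ^+ (q ^ 1) - 1 ^+ (q ^ 0) * 0 ^+ (q ^ 1).
  by have := minor_eq [:: 0; 1]%N; rewrite (minor_01 H) (minor_01 G).
have e02 : h 0 ^+ (q ^ 0) * h 0 ^+ (q ^ 2) - h 2 ^+ (q ^ 0) * h 4 ^+ (q ^ 2) =
    0 ^+ (q ^ 0) * 0 ^+ (q ^ 2) - 0 ^+ (q ^ 0) * (1 * theta) ^+ (q ^ 2).
  by have := minor_eq [:: 0; 2]%N; rewrite (minor_02 H) (minor_02 G).
have e012 :
    - (h 0 ^+ (q ^ 0) * (h 0 ^+ (q ^ 1) * h 0 ^+ (q ^ 2) - h 1 ^+ (q ^ 1) * h 5 ^+ (q ^ 2))
    - h 1 ^+ (q ^ 0) * (h 5 ^+ (q ^ 1) * h 0 ^+ (q ^ 2) - h 1 ^+ (q ^ 1) * h 4 ^+ (q ^ 2))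
    + h 2 ^+ (q ^ 0) * (h 5 ^+ (q ^ 1) * h 5 ^+ (q ^ 2) - h 0 ^+ (q ^ 1) * h 4 ^+ (q ^ 2))) =
    - (0 ^+ (q ^ 0) * (0 ^+ (q ^ 1) * 0 ^+ (q ^ 2) - 1 ^+ (q ^ 1) * 0 ^+ (q ^ 2))
    - 1 ^+ (q ^ 0) * (0 ^+ (q ^ 1) * 0 ^+ (q ^ 2) - 1 ^+ (q ^ 1) * (1 * theta) ^+ (q ^ 2))
    + 0 ^+ (q ^ 0) * (0 ^+ (q ^ 1) * 0 ^+ (q ^ 2) - 0 ^+ (q ^ 1) * (1 * theta) ^+ (q ^ 2))).
  by have := minor_eq [:: 0; 1; 2]%N; rewrite (minor_012 H) (minor_012 G).
have e024 :
    - (h 0 ^+ (q ^ 0) * (h 0 ^+ (q ^ 2) * h 0 ^+ (q ^ 4) - h 2 ^+ (q ^ 2) * h 4 ^+ (q ^ 4))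
    - h 2 ^+ (q ^ 0) * (h 4 ^+ (q ^ 2) * h 0 ^+ (q ^ 4) - h 2 ^+ (q ^ 2) * h 2 ^+ (q ^ 4))
    + h 4 ^+ (q ^ 0) * (h 4 ^+ (q ^ 2) * h 4 ^+ (q ^ 4) - h 0 ^+ (q ^ 2) * h 2 ^+ (q ^ 4))) =
    - (0 ^+ (q ^ 0) * (0 ^+ (q ^ 2) * 0 ^+ (q ^ 4) - 0 ^+ (q ^ 2) * (1 * theta) ^+ (q ^ 4))
    - 0 ^+ (q ^ 0) * ((1 * theta) ^+ (q ^ 2) * 0 ^+ (q ^ 4) - 0 ^+ (q ^ 2) * 0 ^+ (q ^ 4))
    + (1 * theta) ^+ (q ^ 0)
        * ((1 * theta) ^+ (q ^ 2) * (1 * theta) ^+ (q ^ 4) - 0 ^+ (q ^ 2) * 0 ^+ (q ^ 4))).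
  by have := minor_eq [:: 0; 2; 4]%N; rewrite (minor_024 H) (minor_024 G).
have by_diff (a b c d : F) : a = b -> c - d = b - a -> c = d.
  by move->; rewrite subrr => /eqP; rewrite subr_eq0 => /eqP.
have powI x y i : x * y ^+ (q ^ i) = 0 :> F -> x * y = 0.
  move/eqP; rewrite mulf_eq0 expf_eq0 => /orP[/eqP->|/andP[_ /eqP->]];
    by rewrite ?mul0r ?mulr0.
rewrite h0 !frob0 ?(mul1r theta) ?expn0 ?expn1 ?expr1 ?expr1n in e03 e01 e02 e012 e024.
split; first split=> //.
- have /powI/eqP : h 3 * h 3 ^+ (q ^ 3) = 0 by apply: (by_diff _ _ _ _ e03); ring.
  by rewrite mulf_eq0 orbb => /eqP.
- by apply: (powI _ _ 1%N); rewrite expn1; apply: (by_diff _ _ _ _ e01); ring.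
- by apply: (powI _ _ 2%N); apply: (by_diff _ _ _ _ e02); ring.
by split; [apply: (by_diff _ _ _ _ e012); ring | apply: (by_diff _ _ _ _ e024); ring].
Qed.

Let fr (i : nat) (x : F) : F := x ^+ (q ^ i).

Let frM i x y : fr i (x * y) = fr i x * fr i y.
Proof. exact: exprMn. Qed.

Let frfr i j x : fr i (fr j x) = fr ((j + i) %% 6) x.
Proof. by rewrite /fr frob_iter_mod // -exprM -expnD. Qed.

Let fr0 x : fr 0 x = x.
Proof. exact: expr1. Qed.

Let fr_eq0 i x : (fr i x == 0) = (x == 0).
Proof. by rewrite expf_eq0 expn_gt0 q_gt0. Qed.

Let fr_inj i : injective (fr i).
Proof.
move=> x y /eqP; rewrite -subr_eq0 -(frob_iterN q_gt1 frobD) -frob_iterD //.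
by rewrite -/(fr _ _) fr_eq0 subr_eq0 => /eqP.
Qed.

Let norm_fr x y : fr 2 x * fr 5 x = fr 2 y * fr 5 y ->
  x ^+ (q ^ 3).+1 = y ^+ (q ^ 3).+1.
Proof.
move=> xy; apply: (@fr_inj 2); rewrite !exprS -!/(fr 3 _) !frM !frfr; exact: xy.
Qed.

Lemma coefs14_norm (h1 h4 a d delta theta : F) : a != 0 -> d != 0 ->
  h1 * h1 ^+ q * h4 ^+ (q ^ 2) = theta ^+ (q ^ 2) ->
  h4 * h4 ^+ (q ^ 2) * h4 ^+ (q ^ 4) = theta * theta ^+ (q ^ 2) * theta ^+ (q ^ 4) ->
  h1 * a ^+ q = d -> h4 * a ^+ (q ^ 4) = d * delta ->
  delta ^+ (q ^ 3).+1 = theta ^+ (q ^ 3).+1.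
Proof.
rewrite -[q in h1 ^+ q]expn1 -[q in a ^+ q]expn1 -!/(fr _ _).
move=> nza nzd E1 E2 hd; rewrite -hd => E4.
have nzh1 : h1 != 0 by apply: contraNneq nzd => h10; rewrite -hd h10 mul0r.
have nzah : h1 * fr 1 a != 0 by rewrite hd.
have [th0|nzth] := eqVneq theta 0.
  have h40 : h4 = 0.
    apply/eqP; rewrite -(fr_eq0 2); move/eqP: E1.
    by rewrite th0 /fr frob0 -!/(fr _ _) !mulf_eq0 !fr_eq0 (negPf nzh1).
  have /eqP := esym E4; rewrite h40 mul0r mulf_eq0 (negPf nzah) /= => /eqP ->.
  by rewrite th0.
have E1_2 : fr 2 h1 * fr 3 h1 * fr 4 h4 = fr 4 theta.
  by have := congr1 (fr 2) E1; rewrite !frM !frfr.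
have E1_3 : fr 3 h1 * fr 4 h1 * fr 5 h4 = fr 5 theta.
  by have := congr1 (fr 3) E1; rewrite !frM !frfr.
have E1_4 : fr 4 h1 * fr 5 h1 * h4 = theta.
  rewrite -(fr0 h4) -(fr0 theta).
  by have := congr1 (fr 4) E1; rewrite !frM !frfr.
have E4_2 : fr 2 h4 * a = fr 2 h1 * fr 3 a * fr 2 delta.
  rewrite -[X in _ * X = _](fr0 a).
  by have := congr1 (fr 2) E4; rewrite !frM !frfr.
have E4_5 : fr 5 h4 * fr 3 a = fr 5 h1 * a * fr 5 delta.
  rewrite -[X in _ * X * _](fr0 a).
  by have := congr1 (fr 5) E4; rewrite !frM !frfr.
have n1 : h1 * fr 1 h1 * fr 2 h1 * fr 3 h1 * fr 4 h1 * fr 5 h1 = 1.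
  have nzt : theta * fr 2 theta * fr 4 theta != 0 by rewrite !mulf_neq0 ?fr_eq0.
  apply: (mulIf nzt); rewrite mul1r -[X in _ * X]E2 -E1 -E1_2 -[X in _ = X * _ * _]E1_4.
  by ring.
apply: norm_fr.
have nzaa : a * fr 3 a != 0 by rewrite mulf_neq0 ?fr_eq0.
apply: (mulIf nzaa).
rewrite -[LHS]mul1r -n1 -E1 -E1_3.
transitivity (h1 * fr 1 h1 * fr 3 h1 * fr 4 h1 * (fr 2 h1 * fr 3 a * fr 2 delta)
   * (fr 5 h1 * a * fr 5 delta)); first ring.
rewrite -E4_2 -E4_5; ring.
Qed.

Lemma coefs25_norm (h2 h5 b c delta theta : F) : b != 0 -> c != 0 ->
  h2 * h5 ^+ q * h5 ^+ (q ^ 2) = theta ^+ (q ^ 2) ->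
  h2 * h2 ^+ (q ^ 2) * h2 ^+ (q ^ 4) = theta * theta ^+ (q ^ 2) * theta ^+ (q ^ 4) ->
  h2 * (b * delta) ^+ (q ^ 2) + h5 * b ^+ (q ^ 5) = c ->
  h2 * b ^+ (q ^ 2) = - (h5 * (b * delta) ^+ (q ^ 5)) ->
  delta ^+ (q ^ 3).+1 = theta ^+ (q ^ 3).+1.
Proof.
rewrite -[q in h5 ^+ q]expn1 -!/(fr _ _) !frM.
move=> nzb nzc E1 E2 hc E3.
have frN i x : fr i (- x) = - fr i x by apply: frob_iterN.
have [th0|nzth] := eqVneq theta 0.
  have h20 : h2 = 0.
    by apply/eqP; move/eqP: E2; rewrite th0 !mul0r !mulf_eq0 !fr_eq0 !orbb.
  have nzh5 : h5 != 0.
    by apply: contraNneq nzc => h50; rewrite -hc h20 h50 !mul0r addr0.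
  move/eqP: E3; rewrite h20 mul0r eq_sym oppr_eq0 !mulf_eq0 !fr_eq0.
  by rewrite (negPf nzh5) (negPf nzb) /= th0 => /eqP ->.
have E1_2 : fr 2 h2 * fr 3 h5 * fr 4 h5 = fr 4 theta.
  by have := congr1 (fr 2) E1; rewrite !frM !frfr.
have E1_3 : fr 3 h2 * fr 4 h5 * fr 5 h5 = fr 5 theta.
  by have := congr1 (fr 3) E1; rewrite !frM !frfr.
have E1_4 : fr 4 h2 * fr 5 h5 * h5 = theta.
  rewrite -[X in _ * X](fr0 h5) -(fr0 theta).
  by have := congr1 (fr 4) E1; rewrite !frM !frfr.
have E3_3 : fr 3 h2 * fr 5 b = - (fr 3 h5 * (fr 2 b * fr 2 delta)).
  by have := congr1 (fr 3) E3; rewrite frN !frM !frfr.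
have n1 : h5 * fr 1 h5 * fr 2 h5 * fr 3 h5 * fr 4 h5 * fr 5 h5 = 1.
  have nzt : theta * fr 2 theta * fr 4 theta != 0 by rewrite !mulf_neq0 ?fr_eq0.
  apply: (mulIf nzt); rewrite mul1r -[X in _ * X]E2 -E1 -E1_2 -[X in _ = X * _ * _]E1_4.
  by ring.
apply: norm_fr.
have nzbb : fr 2 b * fr 5 b != 0 by rewrite mulf_neq0 ?fr_eq0.
apply: (mulIf nzbb).
rewrite -[LHS]mul1r -n1 -E1 -E1_3.
transitivity (fr 1 h5 * fr 2 h5 * fr 4 h5 * fr 5 h5 * (- (h5 * (fr 5 b * fr 5 delta)))
   * (- (fr 3 h5 * (fr 2 b * fr 2 delta)))); first ring.
rewrite -E3 -E3_3; ring.
Qed.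

Lemma same_slopes_norm (h : nat -> F) (a b c d delta theta : F) :
  a * d - b * c != 0 ->
  (forall m, (exists2 x, x != 0 & qlin q 6 h x = m * x) <->
             (exists2 x, x != 0 & qlin q 6 (qbinomial 0 1 theta) x = m * x)) ->
  (forall j : 'I_6, \sum_(i < 6) h i * dickson_entry q 6 (qbinomial a b delta) i j =
     qbinomial c d delta j) ->
  delta ^+ (q ^ 3).+1 = theta ^+ (q ^ 3).+1.
Proof.
move=> nzdet /same_slopes_coefs[[h0 h3 h15 h24] [E1 E2]] comp.
set u := qbinomial a b delta in comp.
pose S j := h 1 * u ((j + 5) %% 6)%N ^+ (q ^ 1) + h 2 * u ((j + 4) %% 6)%N ^+ (q ^ 2)
  + h 4 * u ((j + 2) %% 6)%N ^+ (q ^ 4) + h 5 * u ((j + 1) %% 6)%N ^+ (q ^ 5).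
have SE j : (j < 6)%N -> S j = qbinomial c d delta j.
  move=> j6; rewrite -(comp (Ordinal j6)) !big_ord_recl big_ord0.
  transitivity (h 0 * dickson_entry q 6 u 0 j + (h 1 * dickson_entry q 6 u 1 j
    + (h 2 * dickson_entry q 6 u 2 j + (h 3 * dickson_entry q 6 u 3 j
    + (h 4 * dickson_entry q 6 u 4 j + (h 5 * dickson_entry q 6 u 5 j + 0)))))) => //.
  by rewrite h0 h3 !mul0r !add0r addr0 !addrA.
have e0 : h 2 * (b * delta) ^+ (q ^ 2) + h 5 * b ^+ (q ^ 5) = c.
  rewrite -[RHS](SE 0%N isT) /S -[u _]/(0 : F).
  by rewrite frob0 mulr0 add0r -[u ((0 + 2) %% 6)%N]/(0 : F) frob0 mulr0 addr0.
have e1 : h 1 * a ^+ q = d.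
  rewrite -[RHS](SE 1%N isT) /S -[u ((1 + 4) %% 6)%N]/(0 : F) -[u ((1 + 2) %% 6)%N]/(0 : F).
  by rewrite -[u ((1 + 1) %% 6)%N]/(0 : F) !frob0 !mulr0 !addr0 expn1.
have e3 : h 2 * b ^+ (q ^ 2) = - (h 5 * (b * delta) ^+ (q ^ 5)).
  apply/eqP; rewrite -subr_eq0 opprK -[X in _ == X](SE 3%N isT) /S.
  rewrite -[u ((3 + 5) %% 6)%N]/(0 : F) -[u ((3 + 2) %% 6)%N]/(0 : F).
  by rewrite !frob0 !mulr0 add0r addr0.
have e4 : h 4 * a ^+ (q ^ 4) = d * delta.
  rewrite -[RHS](SE 4%N isT) /S -[u ((4 + 5) %% 6)%N]/(0 : F).
  rewrite -[u ((4 + 4) %% 6)%N]/(0 : F) -[u ((4 + 1) %% 6)%N]/(0 : F).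
  by rewrite !frob0 !mulr0 !add0r addr0.
have theta0 : theta ^+ (q ^ 2) = 0 -> theta = 0.
  by move/eqP; rewrite -/(fr 2 _) fr_eq0 => /eqP.
have N0 (x : F) : x * x ^+ (q ^ 2) * x ^+ (q ^ 4) = 0 -> x = 0.
  by move/eqP; rewrite -/(fr 2 x) -/(fr 4 x) !mulf_eq0 !fr_eq0 !orbb => /eqP.
have case14 : h 2 = 0 -> h 5 = 0 -> delta ^+ (q ^ 3).+1 = theta ^+ (q ^ 3).+1.
  move=> h20 h50; have c0 : c = 0 by rewrite -e0 h20 h50 !mul0r addr0.
  move: nzdet; rewrite c0 mulr0 subr0 mulf_eq0 negb_or => /andP[nza nzd].
  apply: (coefs14_norm nza nzd _ _ e1 e4).
    by rewrite -E1 h20 !mul0r addr0.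
  by rewrite -E2 h20 !mul0r add0r.
have case25 : h 1 = 0 -> h 4 = 0 -> delta ^+ (q ^ 3).+1 = theta ^+ (q ^ 3).+1.
  move=> h10 h40; have d0 : d = 0 by rewrite -e1 h10 mul0r.
  move: nzdet; rewrite d0 mulr0 sub0r oppr_eq0 mulf_eq0 negb_or => /andP[nzb nzc].
  apply: (coefs25_norm nzb nzc _ _ e0 e3).
    by rewrite -E1 h10 !mul0r add0r.
  by rewrite -E2 h40 !mul0r addr0.
have [h10|nzh1] := eqVneq (h 1) 0.
  have [h40|nzh4] := eqVneq (h 4) 0; first exact: case25.
  have h20 : h 2 = 0 by apply/eqP; move/eqP: h24; rewrite mulf_eq0 (negPf nzh4) orbF.
  have th0 : theta = 0 by apply: theta0; rewrite -E1 h10 h20 !mul0r addr0.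
  by apply: case25 => //; apply: N0; move: E2; rewrite h20 th0 !mul0r add0r.
have h50 : h 5 = 0 by apply/eqP; move/eqP: h15; rewrite mulf_eq0 (negPf nzh1).
have [h20|nzh2] := eqVneq (h 2) 0; first exact: case14.
have h40 : h 4 = 0 by apply/eqP; move/eqP: h24; rewrite mulf_eq0 (negPf nzh2).
have th0 : theta = 0.
  by apply: theta0; rewrite -E1 h40 h50 !frob0 !mulr0 addr0.
by apply: case14 => //; apply: N0; move: E2; rewrite h40 th0 !mul0r addr0.
Qed.

Lemma collineation_norm (a b c d delta theta : F) :
  let f x := x ^+ q + delta * x ^+ (q ^ 4) in
  let g x := x ^+ q + theta * x ^+ (q ^ 4) in
  a * d - b * c != 0 ->
  (forall x, x != 0 ->
     exists2 y, y != 0 & (a * x + b * f x) * g y = y * (c * x + d * f x)) ->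
  (forall y, y != 0 ->
     exists2 x, x != 0 & (a * x + b * f x) * g y = y * (c * x + d * f x)) ->
  delta ^+ (q ^ 3).+1 = theta ^+ (q ^ 3).+1.
Proof.
move=> f g nzdet Hx Hy.
pose u := qbinomial a b delta; pose w := qbinomial c d delta.
have uE x : qlin q 6 u x = a * x + b * f x by apply: qlin_binomial.
have wE x : qlin q 6 w x = c * x + d * f x by apply: qlin_binomial.
have gE y : qlin q 6 (qbinomial 0 1 theta) y = g y.
  by rewrite qlin_binomial mul0r add0r mul1r.
have u0 x : qlin q 6 u x = 0 -> x = 0.
  move=> ux; apply/eqP/negPn/negP => nzx; have [y nzy] := Hx x nzx.
  rewrite -uE -wE ux mul0r => /esym/eqP; rewrite mulf_eq0 (negPf nzy) /= => /eqP wx.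
  suff /eqP : x * (a * d - b * c) = 0 by rewrite mulf_eq0 (negPf nzx) (negPf nzdet).
  transitivity (d * (a * x + b * f x) - b * (c * x + d * f x)); first ring.
  by rewrite -uE -wE ux wx !mulr0 subrr.
have [h [hu comp]] := qlin_right_factor (n := 6) q_gt1 isT cardF frobD w u0.
apply: (same_slopes_norm nzdet _ comp) => m; split=> -[z nzz zm].
  have [u' _ uK] := qlin_bij q_gt1 frobD u0.
  have nzx : u' z != 0.
    by apply: contraNneq nzz => x0; rewrite -(uK z) x0 qlin_at0.
  have [y nzy] := Hx _ nzx; rewrite -uE -wE uK -hu uK zm => e.
  by exists y => //; rewrite gE; apply: (mulfI nzz); rewrite e; ring.
have [x nzx] := Hy z nzz; rewrite -uE -wE -gE zm -hu => e.
exists (qlin q 6 u x); first by apply: contra_neq nzx => /u0.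
by apply: (mulfI nzz); rewrite -e; ring.
Qed.

End NormOfBinomials.

Lemma hilbert90_quadratic (F : finFieldType) Q (u : F) :
  (1 < Q)%N -> #|F| = (Q ^ 2)%N ->
  (forall x y : F, (x + y) ^+ Q = x ^+ Q + y ^+ Q) -> u ^+ Q.+1 = 1 ->
  exists2 l : F, l != 0 & l ^+ Q = u * l.
Proof.
move=> Q1 cF QD uQ.
have nzu : u != 0 by apply: contra_eq_neq uQ => ->; rewrite expr0n eq_sym oner_eq0.
pose P : {poly F} := 'X + u^-1 *: 'X^Q.
have [/existsP[y nzy]|all0] := boolP [exists y, P.[y] != 0].
  exists P.[y] => //; rewrite /P !hornerE QD exprMn -exprM mulnn -cF expf_card.
  rewrite exprVn mulrDr mulrA mulfV // mul1r addrC; congr (_ + _).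
  by congr (_ * _); apply: (mulfI (expf_neq0 Q nzu)); rewrite mulfV ?expf_neq0 // -exprSr.
have P0 : P = 0.
  apply: poly_eq_on_finField; rewrite ?size_poly0 //; last first.
    by move=> x; apply/eqP; rewrite horner0; move/existsPn/(_ x): all0; rewrite negbK.
  rewrite cF (leq_trans (size_polyD _ _)) // geq_max size_polyX.
  rewrite (leq_trans (size_scale_leq _ _)) ?size_polyXn; nia.
have := congr1 (fun R : {poly F} => R`_1) P0.
rewrite coef0 coefD coefX coefZ coefXn (ltn_eqF Q1) mulr0 addr0 => /eqP.
by rewrite oner_eq0.
Qed.

Section Automorphisms.

Variables (p : nat) (F : finFieldType).
Hypothesis pcharF : p \in [pchar F].

Let p_prime : prime p := pcharf_prime pcharF.

Lemma exists_frobenius_iter j :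
  exists2 tau : {rmorphism F -> F}, bijective tau & tau =1 (fun x => x ^+ (p ^ j)).
Proof.
suff [tau tauE] : exists tau : {rmorphism F -> F}, tau =1 (fun x => x ^+ (p ^ j)).
  by exists tau => //; apply: injF_bij; apply: fmorph_inj.
elim: j => [|j [tau tauE]]; first by exists idfun.
exists (pFrobenius_aut pcharF \o tau : {rmorphism F -> F}) => x /=.
by rewrite tauE pFrobenius_autE -exprM -expnSr.
Qed.

Lemma prime_field_nat (c : F) : c ^+ p = c -> exists n, c = n%:R.
Proof.
move=> cp; pose s := [seq i%:R | i <- iota 0 p] : seq F.
suff /mapP[n _ ->] : c \in s by exists n.
apply/negPn/negP => cs.
have szP : size ('X^p - 'X : {poly F}) = p.+1.
  by rewrite size_polyDl ?size_polyXn // size_polyN size_polyX ltnS prime_gt1.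
have nzP : 'X^p - 'X != 0 :> {poly F} by rewrite -size_poly_eq0 szP.
have le_inj i j : (j < p)%N -> (i <= j)%N -> i%:R = j%:R :> F -> i = j.
  move=> jp ij /eqP; rewrite eq_sym -subr_eq0 -natrB // -(dvdn_pcharf pcharF).
  by have [|ji /(dvdn_leq ji)] := posnP (j - i)%N; lia.
have us : uniq s.
  rewrite map_inj_in_uniq ?iota_uniq // => i j; rewrite !mem_iota !add0n /= => ip jp e.
  by case: (leqP i j) => [|/ltnW] ij; [|symmetry]; apply: le_inj.
have := max_poly_roots nzP _ _ (rs := c :: s).
rewrite szP /= size_map size_iota ltnn cs us => /(_ _ isT) H.
suff: false by []; apply: H.
rewrite /root !hornerE cp subrr eqxx; apply/allP => _ /mapP[i _ ->].
by rewrite /root !hornerE -pFrobenius_autE pFrobenius_aut_nat subrr.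
Qed.

Lemma subfield_aut_conj m (sigma : F -> F) T :
  (0 < m)%N -> subfield_aut (subfield_of_order F (p ^ m)) sigma ->
  T ^+ (p ^ m) = T -> exists2 j, (j < m)%N & sigma T = T ^+ (p ^ j).
Proof.
set K := subfield_of_order F (p ^ m).
move=> m_gt0 [_ _ sigma1 sigmaD sigmaM] TK.
have [tau _ tauE] := exists_frobenius_iter m.
have KE x : (x \in K) = (tau x == x) by rewrite inE tauE.
have K0 : 0 \in K by rewrite KE rmorph0.
have K1 : 1 \in K by rewrite KE rmorph1.
have KD : {in K &, forall x y, x + y \in K}.
  by move=> x y; rewrite !KE rmorphD => /eqP-> /eqP->.
have KM : {in K &, forall x y, x * y \in K}.
  by move=> x y; rewrite !KE rmorphM => /eqP-> /eqP->.
have Tin : T \in K by rewrite KE tauE TK.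
have sigma0 : sigma 0 = 0.
  by apply: (addrI (sigma 0)); rewrite -sigmaD // !addr0.
have sigma_nat n : (n%:R \in K) && (sigma n%:R == n%:R).
  elim: n => [|n /andP[nK /eqP IH]]; first by rewrite K0 sigma0 eqxx.
  by rewrite -natr1 KD //= sigmaD // IH sigma1.
pose P := \prod_(j < m) ('X - (T ^+ (p ^ j))%:P).
have frobP : map_poly (pFrobenius_aut pcharF) P = P.
  rewrite rmorph_prod /P.
  case: m m_gt0 TK {K tau tauE KE K0 K1 KD KM Tin sigmaD sigmaM sigma0 sigma_nat P} => // m _ TK.
  rewrite big_ord_recr big_ord_recl [LHS]mulrC /=; congr (_ * _).
    by rewrite map_polyXsubC /= pFrobenius_autE -exprM -expnSr TK expr1.
  apply: eq_bigr => j _.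
  by rewrite map_polyXsubC /= pFrobenius_autE -exprM -expnSr.
have coefP i : P`_i ^+ p = P`_i.
  by rewrite -[in RHS]frobP coef_map /= pFrobenius_autE.
have sigmaP (R : {poly F}) : (forall i, R`_i ^+ p = R`_i) ->
    (R.[T] \in K) && (sigma R.[T] == R.[sigma T]).
  elim/poly_ind: R => [|R c IH] coefR; first by rewrite !horner0 K0 sigma0 eqxx.
  have /andP[RK /eqP RE] : (R.[T] \in K) && (sigma R.[T] == R.[sigma T]).
    by apply: IH => i; have := coefR i.+1; rewrite coefD coefMX coefC /= addr0.
  have [n cE] : exists n, c = n%:R.
    by apply: prime_field_nat; have := coefR 0%N; rewrite coefD coefMX coefC /= add0r.
  have /andP[nK /eqP nE] := sigma_nat n.
  by rewrite !hornerE cE KD ?KM //= sigmaD ?KM // sigmaM // RE nE.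
have /andP[_ /eqP] := sigmaP P coefP.
have -> : P.[T] = 0.
  apply/eqP; rewrite horner_prod prodf_seq_eq0; apply/hasP.
  by exists (Ordinal m_gt0); rewrite ?mem_index_enum // !hornerE expr1 subrr.
rewrite sigma0 horner_prod => /esym/eqP; rewrite prodf_seq_eq0.
case/hasP => j _; rewrite !hornerE subr_eq0 => /eqP sT.
by exists j.
Qed.

End Automorphisms.

Section Points.

Variable F : finFieldType.
Implicit Types (x y : F) (v w : 'rV[F]_2) (phi : 'rV[F]_2 -> 'rV[F]_2).

Lemma vec2E v : v = vec2 (v 0 0) (v 0 1).
Proof.
by apply/rowP => i; rewrite mxE; case: ifP => [/eqP->|] //; case: i => -[|[]] // ? _;
  congr (v 0 _); apply: val_inj.
Qed.

Lemma mem_point v : v \in point v.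
Proof. by rewrite inE memv_line. Qed.

Lemma point_eq_cross v w : point v = point w -> v 0 0 * w 0 1 = w 0 0 * v 0 1.
Proof.
move=> vw; have := mem_point v; rewrite vw inE => /vlineP[k ->].
by rewrite !mxE mulrCA mulrA mulrC mulrA.
Qed.

Lemma GammaL2_point phi v : GammaL2 phi -> phi @: point v = point (phi v).
Proof.
case=> _ [tau [[tau' tauK tau'K] phiE]].
have phi0 : phi 0 = 0.
  have := phiE 1 0 0; rewrite scaler0 addr0 rmorph1 scale1r => e.
  by apply: (addrI (phi 0)); rewrite -e addr0.
have phiZ k u : phi (k *: u) = tau k *: phi u.
  by have := phiE k u 0; rewrite phi0 !addr0.
apply/setP => w; rewrite inE; apply/imsetP/vlineP.
  by case=> u; rewrite inE => /vlineP[k ->] ->; exists (tau k); rewrite phiZ.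
case=> k ->; exists (tau' k *: v); last by rewrite phiZ tau'K.
by rewrite inE; apply/vlineP; exists (tau' k).
Qed.

End Points.

Section Equivalence.

Variables (p k : nat) (F : finFieldType).
Hypothesis p_prime : prime p.
Hypothesis k_gt0 : (0 < k)%N.
Let q := (p ^ k)%N.
Hypothesis cardF : #|F| = (q ^ 6)%N.

Let pcharF : p \in [pchar F].
Proof. by apply: (@card_finPcharP _ _ (k * 6)) => //; rewrite expnM. Qed.

Let q_gt1 : (1 < q)%N.
Proof. by rewrite -(expn0 p) ltn_exp2l ?prime_gt1. Qed.

Let expD i (x y : F) : (x + y) ^+ (p ^ i) = x ^+ (p ^ i) + y ^+ (p ^ i).
Proof. by apply: exprDn_pchar; rewrite pnatX pnatE ?pcharF. Qed.

Let frobD (x y : F) : (x + y) ^+ q = x ^+ q + y ^+ q.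
Proof. exact: expD. Qed.

Let binom (d : F) : {poly F} := 'X^q + d *: 'X^(q ^ 4).

Let hornerB d x : (binom d).[x] = x ^+ q + d * x ^+ (q ^ 4).
Proof. by rewrite !hornerE. Qed.

Lemma equivalent_norm delta theta :
  PGammaL_equivalent (linear_set (binom delta)) (linear_set (binom theta)) ->
  exists2 sigma : F -> F,
    subfield_aut (subfield_of_order F (q ^ 3)) sigma &
    quadratic_norm (q ^ 3) delta = sigma (quadratic_norm (q ^ 3) theta).
Proof.
case=> phi Gphi LE; have [[phi' phiK _] [tau [[tau' tauK tau'K] phiE]]] := Gphi.
have phi0 : phi 0 = 0.
  have := phiE 1 0 0; rewrite scaler0 addr0 rmorph1 scale1r => e.
  by apply: (addrI (phi 0)); rewrite -e addr0.
pose a := phi (vec2 1 0) 0 0; pose c := phi (vec2 1 0) 0 1.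
pose b := phi (vec2 0 1) 0 0; pose d := phi (vec2 0 1) 0 1.
have phi_vec x y : phi (vec2 x y) =
    vec2 (a * tau x + b * tau y) (c * tau x + d * tau y).
  have -> : vec2 x y = x *: vec2 1 0 + (y *: vec2 0 1 + 0).
    by apply/rowP => i; rewrite !mxE; case: ifP => _; ring.
  rewrite !phiE phi0 addr0 [phi (vec2 1 0)]vec2E [phi (vec2 0 1)]vec2E.
  by apply/rowP => i; rewrite !mxE; case: ifP => _; rewrite /a /b /c /d; ring.
have phi_inj0 x y : phi (vec2 x y) = 0 -> x = 0 /\ y = 0.
  rewrite -phi0 => /(can_inj phiK) /rowP e.
  by have := e 0; have := e 1; rewrite !mxE.
have nzdet : a * d - b * c != 0.
  apply/negP => /eqP det0.
  have tau'0 x : tau' x = 0 -> x = 0 by move=> e; rewrite -(tau'K x) e rmorph0.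
  have : phi (vec2 (tau' b) (tau' (- a))) = 0.
    rewrite phi_vec !tau'K; apply/rowP => i; rewrite !mxE; case: ifP => _; first by ring.
    by rewrite -[RHS]oppr0 -det0; ring.
  case/phi_inj0 => /tau'0 b0 /tau'0/eqP; rewrite oppr_eq0 => /eqP a0.
  have : phi (vec2 (tau' d) (tau' (- c))) = 0.
    rewrite phi_vec !tau'K; apply/rowP => i; rewrite !mxE; case: ifP => _; last by ring.
    by rewrite -det0; ring.
  case/phi_inj0 => /tau'0 d0 /tau'0/eqP; rewrite oppr_eq0 => /eqP c0.
  have : phi (vec2 1 0) = 0.
    by rewrite phi_vec a0 b0 c0 d0; apply/rowP => i; rewrite !mxE; case: ifP => _; ring.
  by case/phi_inj0 => /eqP; rewrite oner_eq0.
have tau_f x : tau (binom delta).[x] = tau x ^+ q + tau delta * tau x ^+ (q ^ 4).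
  by rewrite hornerB rmorphD rmorphM /= !rmorphXn.
have nz_tau' x : x != 0 -> tau' x != 0.
  by apply: contra_neq => e; rewrite -(tau'K x) e rmorph0.
have cross x y :
    phi @: point (vec2 (tau' x) (binom delta).[tau' x]) = point (vec2 y (binom theta).[y]) ->
    (a * x + b * (x ^+ q + tau delta * x ^+ (q ^ 4))) * (y ^+ q + theta * y ^+ (q ^ 4)) =
    y * (c * x + d * (x ^+ q + tau delta * x ^+ (q ^ 4))).
  rewrite GammaL2_point // => /point_eq_cross.
  by rewrite phi_vec tau_f tau'K !mxE /= hornerB.
have norm_eq : tau delta ^+ (q ^ 3).+1 = theta ^+ (q ^ 3).+1.
  apply: (collineation_norm q_gt1 cardF frobD nzdet) => x nzx.
    have : phi @: point (vec2 (tau' x) (binom delta).[tau' x]) \in linear_set (binom theta).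
      by rewrite -LE; do 2!apply: imset_f; rewrite ?inE ?nz_tau'.
    by case/imsetP => y; rewrite inE => nzy /cross e; exists y.
  have : point (vec2 x (binom theta).[x]) \in linear_set (binom theta).
    by apply: imset_f; rewrite inE.
  rewrite -LE => /imsetP[_ /imsetP[z + ->] e]; rewrite inE => nzz.
  exists (tau z); first by rewrite fmorph_eq0.
  by apply: cross; rewrite tauK e.
have tau'_inj : injective tau' := can_inj tau'K.
exists tau'; last by apply: (can_inj tauK); rewrite tau'K /quadratic_norm rmorphXn.
have KE x : (tau x \in subfield_of_order F (q ^ 3)) = (x \in subfield_of_order F (q ^ 3)).
  by rewrite !inE -rmorphXn (inj_eq (can_inj tauK)).
split.
- by move=> x y _ _; apply: tau'_inj.
- apply/setP => x; apply/imsetP/idP => [[y yK ->]|xK]; first by rewrite -KE tau'K.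
  by exists (tau x); rewrite ?KE ?tauK.
- by apply: (can_inj tauK); rewrite tau'K rmorph1.
- by move=> x y _ _; apply: (can_inj tauK); rewrite rmorphD !tau'K.
- by move=> x y _ _; apply: (can_inj tauK); rewrite rmorphM !tau'K.
Qed.

Lemma norm_equivalent delta theta (sigma : F -> F) :
  subfield_aut (subfield_of_order F (q ^ 3)) sigma ->
  quadratic_norm (q ^ 3) delta = sigma (quadratic_norm (q ^ 3) theta) ->
  PGammaL_equivalent (linear_set (binom delta)) (linear_set (binom theta)).
Proof.
set Q := (q ^ 3)%N; have QE : Q = (p ^ (k * 3))%N by rewrite expnM.
have cardQ : #|F| = (Q ^ 2)%N by rewrite cardF -(expnM q 3 2).
have normK (x : F) : quadratic_norm Q x ^+ Q = quadratic_norm Q x.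
  by rewrite /quadratic_norm -exprM mulSn mulnn -cardQ exprD expf_card mulrC -exprS.
rewrite {1}QE => /(subfield_aut_conj pcharF) H.
have [||j jm -> normE] := H (quadratic_norm Q theta).
- by rewrite muln_gt0 k_gt0.
- by rewrite -QE normK.
have [tau tau_bij tauE] := exists_frobenius_iter pcharF (k * 3 - j).
have {normE} normE : tau delta ^+ Q.+1 = theta ^+ Q.+1.
  rewrite -rmorphXn -/(quadratic_norm Q delta) normE tauE -exprM -expnD subnKC 1?ltnW //.
  by rewrite -QE normK.
have [a nza aE] : exists2 a : F, a != 0 & tau delta * a ^+ q = theta * a ^+ (q ^ 4).
  have [th0|nzth] := eqVneq theta 0.
    exists 1; rewrite ?oner_eq0 // th0 !expr1n mul0r mulr1.
    by apply/eqP; move/eqP: normE; rewrite th0 expr0n expf_eq0.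
  have [||||l nzl lE] := @hilbert90_quadratic F Q (tau delta / theta).
  - by rewrite -(exp1n 3) ltn_exp2r.
  - exact: cardQ.
  - by move=> x y; rewrite QE expD.
  - by rewrite expr_div_n normE divff // expf_neq0.
  exists (l ^+ (q ^ 5)); first exact: expf_neq0.
  rewrite -!exprM -expnSr -expnD -cardF expf_card.
  have -> : (q ^ (5 + 4) = q ^ 6 * Q)%N by rewrite -expnD.
  by rewrite exprM -cardF expf_card lE mulrA mulrCA divff // mulr1.
have [tau' tauK tau'K] := tau_bij.
pose phi (v : 'rV[F]_2) := vec2 (a * tau (v 0 0)) (a ^+ q * tau (v 0 1)).
have Gphi : GammaL2 phi.
  split; last first.
    exists tau; split=> // x u v; apply/rowP => i; rewrite !mxE.
    by case: ifP => _; rewrite rmorphD rmorphM mulrDr mulrCA.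
  exists (fun v : 'rV[F]_2 => vec2 (tau' (v 0 0 / a)) (tau' (v 0 1 / a ^+ q))) => v.
    by rewrite [RHS]vec2E !mxE /= ![_ * tau _]mulrC !mulfK ?expf_neq0 // !tauK.
  by rewrite [RHS]vec2E /phi !mxE /= !tau'K ![_ * (_ / _)]mulrC !divfK ?expf_neq0.
exists phi => //.
have phi_point x : phi @: point (vec2 x (binom delta).[x]) =
    point (vec2 (a * tau x) (binom theta).[a * tau x]).
  rewrite GammaL2_point // /phi !mxE /=; congr (point (vec2 _ _)).
  rewrite !hornerB rmorphD rmorphM /= !rmorphXn !exprMn mulrDr; congr (_ + _).
  by rewrite mulrA [_ ^+ q * _]mulrC aE mulrA.
apply/setP => P; apply/imsetP/imsetP => [[_ /imsetP[x + ->] ->]|[z + ->]]; rewrite inE => nz.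
  by exists (a * tau x) => //; rewrite inE mulf_neq0 ?fmorph_eq0.
exists (point (vec2 (tau' (z / a)) (binom delta).[tau' (z / a)])).
  apply: imset_f; rewrite inE; apply: contra_neq nz => e.
  by rewrite -[z](divfK nza) -(tau'K (z / a)) e rmorph0 mul0r.
by rewrite phi_point tau'K mulrC divfK.
Qed.

End Equivalence.

Theorem theorem4p5 (q : nat) (F : finFieldType) (delta theta : F) :
  prime_power q ->
  #|F| = (q ^ 6)%N ->
  let f : {poly F} := 'X^q + delta *: 'X^(q ^ 4) in
  let g : {poly F} := 'X^q + theta *: 'X^(q ^ 4) in
  PGammaL_equivalent (linear_set f) (linear_set g) <->
  exists2 sigma : F -> F,
    subfield_aut (subfield_of_order F (q ^ 3)) sigma &
    quadratic_norm (q ^ 3) delta = sigma (quadratic_norm (q ^ 3) theta).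
Proof.
case=> p [k [p_prime k_gt0 ->]] cardF f g; split.
  exact: equivalent_norm.
by case=> sigma; apply: norm_equivalent.
Qed.
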